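(* Let $R$ be a Noetherian local duo-ring with maximal ideal $\mathcal{M}$. Then the following are equivalent: (1) $R$ is an FGC-ring; (2) $R$ is a left FGC-ring; (3) every left $R$-module generated by two elements is a direct sum of cyclic modules; (4) either $R$ is an Artinian principal ideal ring or $R$ is a principal ideal domain; (5) $R$ is a principal ideal ring. Moreover, these are also equivalent to each of: $R$ is a right FGC-ring; every right $R$-module generated by two elements is a direct sum of cyclic modules.
   Context: All rings have identity and modules are unital. A ring is local if it has a unique maximal left ideal $\mathcal{M}$. A duo-ring is a ring in which every one-sided (left or right) ideal is two-sided. ''Noetherian'' and ''Artinian'' mean both left and right. A left (resp. right) FGC-ring is a ring over which every finitely generated left (resp. right) module is a direct sum of cyclic submodules; an FGC-ring is a ring that is both left and right FGC. A principal ideal ring is a ring in which every left ideal and every right ideal is principal. A principal ideal domain is a domain in which every left ideal and every right ideal is principal. *)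

(* Defs.v *)
(* Noncommutative rings are [nzRingType]s (nonzero rings with 1);
   left modules are [lmodType R]; right R-modules are left modules over the
   converse ring [R^c]. Ideals are Prop-valued predicates on R. *)
From HB Require Import structures.
From mathcomp Require Import all_boot all_order all_algebra.
Set Implicit Arguments. Unset Strict Implicit. Unset Printing Implicit Defensive.
Import GRing.Theory.
Local Open Scope ring_scope.

Section RingDefs.
Variable R : nzRingType.

Definition left_ideal (I : R -> Prop) : Prop :=
  [/\ I 0, (forall x y, I x -> I y -> I (x + y)) & (forall r x, I x -> I (r * x))].
Definition right_ideal (I : R -> Prop) : Prop :=
  [/\ I 0, (forall x y, I x -> I y -> I (x + y)) & (forall r x, I x -> I (x * r))].
Definition two_sided_ideal (I : R -> Prop) : Prop := left_ideal I /\ right_ideal I.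

Definition duo_ring : Prop :=
  (forall I, left_ideal I -> two_sided_ideal I) /\
  (forall I, right_ideal I -> two_sided_ideal I).

Definition maximal_left_ideal (I : R -> Prop) : Prop :=
  [/\ left_ideal I, ~ I 1 &
      forall J, left_ideal J -> ~ J 1 -> (forall x, I x -> J x) -> forall x, J x -> I x].

Definition local_ring : Prop :=
  exists Mx, maximal_left_ideal Mx /\
    forall N, maximal_left_ideal N -> forall x, N x <-> Mx x.

Definition left_noetherian : Prop :=
  forall I : nat -> R -> Prop, (forall n, left_ideal (I n)) ->
    (forall n x, I n x -> I n.+1 x) ->
    exists N, forall n, (N <= n)%N -> forall x, I n x -> I N x.
Definition right_noetherian : Prop :=
  forall I : nat -> R -> Prop, (forall n, right_ideal (I n)) ->
    (forall n x, I n x -> I n.+1 x) ->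
    exists N, forall n, (N <= n)%N -> forall x, I n x -> I N x.
Definition noetherian : Prop := left_noetherian /\ right_noetherian.

Definition left_artinian : Prop :=
  forall I : nat -> R -> Prop, (forall n, left_ideal (I n)) ->
    (forall n x, I n.+1 x -> I n x) ->
    exists N, forall n, (N <= n)%N -> forall x, I N x -> I n x.
Definition right_artinian : Prop :=
  forall I : nat -> R -> Prop, (forall n, right_ideal (I n)) ->
    (forall n x, I n.+1 x -> I n x) ->
    exists N, forall n, (N <= n)%N -> forall x, I N x -> I n x.
Definition artinian : Prop := left_artinian /\ right_artinian.

Definition principal_left_ideal (I : R -> Prop) : Prop :=
  exists a : R, forall x, I x <-> exists r, x = r * a.
Definition principal_right_ideal (I : R -> Prop) : Prop :=
  exists a : R, forall x, I x <-> exists r, x = a * r.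

Definition principal_ideal_ring : Prop :=
  (forall I, left_ideal I -> principal_left_ideal I) /\
  (forall I, right_ideal I -> principal_right_ideal I).

(* domain: nonzero ring (built into nzRingType) without zero divisors *)
Definition domain : Prop := forall a b : R, a * b = 0 -> a = 0 \/ b = 0.

Definition principal_ideal_domain : Prop := domain /\ principal_ideal_ring.

End RingDefs.

Section ModDefs.
Variables (R : nzRingType) (M : lmodType R).

Definition finitely_generated : Prop :=
  exists (n : nat) (x : 'I_n -> M),
    forall m : M, exists c : 'I_n -> R, m = \sum_(i < n) c i *: x i.

Definition generated_by_two : Prop :=
  exists x y : M, forall m : M, exists a b : R, m = a *: x + b *: y.

(* M is the internal direct sum of the cyclic submodules R x_i, i < n *)
Definition direct_sum_of_cyclic : Prop :=
  exists (n : nat) (x : 'I_n -> M),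
    (forall m : M, exists c : 'I_n -> R, m = \sum_(i < n) c i *: x i) /\
    (forall c : 'I_n -> R, \sum_(i < n) c i *: x i = 0 -> forall i, c i *: x i = 0).
End ModDefs.

Definition left_FGC (R : nzRingType) : Prop :=
  forall M : lmodType R, finitely_generated M -> direct_sum_of_cyclic M.
(* right modules = left modules over the converse ring R^c *)
Definition right_FGC (R : nzRingType) : Prop :=
  forall M : lmodType R^c, finitely_generated M -> direct_sum_of_cyclic M.
Definition FGC (R : nzRingType) : Prop := left_FGC R /\ right_FGC R.

Definition left_two_gen_cyclic (R : nzRingType) : Prop :=
  forall M : lmodType R, generated_by_two M -> direct_sum_of_cyclic M.
Definition right_two_gen_cyclic (R : nzRingType) : Prop :=
  forall M : lmodType R^c, generated_by_two M -> direct_sum_of_cyclic M.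

(* Main.v *)
(** In a duo ring one-sided principal ideals satisfy R x = x R, so all the
    conditions pass to the converse ring and only left modules matter.

    If two-generated left modules split, apply this to R^2 / R (x, y) with x, y in
    the maximal ideal: the splitting forces x R + y R to be principal, and
    Noetherianity then makes every ideal principal.

    Conversely, if the maximal ideal is R p, every nonzero element is a unit times
    a power of p.  Hence R is Artinian or a domain according to whether p is
    nilpotent, and a relation of least valuation among the generators of a module
    splits off a cyclic summand. *)
Require Import Defs.
From HB Require Import structures.
From mathcomp Require Import all_boot all_order all_algebra.
From mathcomp Require Import boolp.

Set Implicit Arguments. Unset Strict Implicit. Unset Printing Implicit Defensive.
Import GRing.Theory.
Local Open Scope ring_scope.

(** * Noetherian maximality and the elementwise form of a local duo-ring *)

Section Rings.
Variable R : nzRingType.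

Definition invertible (x : R) : Prop := exists y, y * x = 1 /\ x * y = 1.

(** Without a maximal member, choice gives each member of [F] a strictly larger one, and iterating
    from [I0] contradicts the chain condition. *)
Lemma left_noetherian_maximal (F : (R -> Prop) -> Prop) :
  left_noetherian R -> (forall I, F I -> left_ideal I) -> (exists I, F I) ->
  exists I, F I /\ forall J, F J -> (forall x, I x -> J x) -> forall x, J x -> I x.
Proof.
move=> noeth Fideal [I0 FI0]; apply: contrapT => nomax.
have step (I : {I | F I}) : exists J : {J | F J},
    (forall x, sval I x -> sval J x) /\ exists x, sval J x /\ ~ sval I x.
  case: I => I FI /=; apply: contrapT => noJ; apply: nomax; exists I; split=> //.
  move=> J FJ IJ x Jx; apply: contrapT => nIx; apply: noJ.
  by exists (exist _ J FJ) => /=; split=> //; exists x.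
have [f fP] := choice step.
pose c n := iter n f (exist _ I0 FI0).
have [|n x|N NP] := noeth (fun n => sval (c n)).
- by move=> n; apply: Fideal; exact: svalP.
- by have [+ _] := fP (c n); apply.
- have [_ [x [cx ncx]]] := fP (c N).
  by apply: ncx; apply: (NP N.+1) => //.
Qed.

(** The fields, taken together, are stable under reversing products, so results derived from them
    can be applied to [R^c] as well. *)
Record local_duo (m : R -> Prop) : Prop := LocalDuo {
  duo_lr : forall r x : R, exists s, r * x = x * s;
  duo_rl : forall x r : R, exists s, x * r = s * x;
  max0 : m 0;
  maxD : forall x y, m x -> m y -> m (x + y);
  maxMl : forall r x : R, m x -> m (r * x);
  maxMr : forall x r : R, m x -> m (x * r);
  max_proper : ~ m 1;
  max_compl : forall x : R, ~ m x -> invertible x }.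

Lemma local_duoP :
  left_noetherian R -> local_ring R -> duo_ring R -> exists m, local_duo m.
Proof.
move=> noeth [m [[mideal m1 mmax] muniq]] [dl dr]; exists m.
have leftP (x : R) : left_ideal (fun z => exists r, z = r * x).
  split; first by exists 0; rewrite mul0r.
    by move=> _ _ [a ->] [b ->]; exists (a + b); rewrite mulrDl.
  by move=> r _ [a ->]; exists (r * a); rewrite mulrA.
have rightP (x : R) : right_ideal (fun z => exists r, z = x * r).
  split; first by exists 0; rewrite mulr0.
    by move=> _ _ [a ->] [b ->]; exists (a + b); rewrite mulrDr.
  by move=> r _ [a ->]; exists (a * r); rewrite mulrA.
have lr (r x : R) : exists s, r * x = x * s.
  have [[_ _ h] _] := dr _ (rightP x).
  by apply: h; exists 1; rewrite mulr1.
have rl (x r : R) : exists s, x * r = s * x.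
  have [_ [_ _ h]] := dl _ (leftP x).
  by apply: h; exists 1; rewrite mul1r.
have [[m0 mD mMl] [_ _ mMr]] := dl _ mideal.
split=> //; first by move=> x r; exact: mMr.
move=> x nmx.
(* If R x were proper, a proper left ideal maximal among those containing [x] would be [m], putting
   [x] in [m]. *)
have [y yx] : exists y, 1 = y * x.
  apply: contrapT => nx; apply: nmx.
  pose F I := [/\ left_ideal I, ~ I 1 & I x].
  have [||I [[Iid I1 Ix] Imax]] := left_noetherian_maximal (F := F) noeth.
  - by move=> I [].
  - by exists (fun z => exists r, z = r * x); split=> //; exists 1; rewrite mul1r.
  - apply/(muniq I) => //; split=> // J Jid J1 IJ; apply: Imax => //.
    by split=> //; apply: IJ.
(* Moving the left inverse across [x] produces a right inverse, and the two agree. *)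
have [z yz] := lr y x.
exists y; split=> //; rewrite yz in yx.
have zy : z = y by rewrite -[z]mul1r yx -yz -mulrA -yx mulr1.
by rewrite yx zy.
Qed.

End Rings.

Lemma local_duo_converse (R : nzRingType) (m : R -> Prop) :
  local_duo m -> @local_duo R^c m.
Proof.
case=> lr rl m0 mD mMl mMr m1 mU; split=> //.
- by move=> r x; have [s] := rl x r; exists s.
- by move=> x r; have [s] := lr r x; exists s.
- by move=> r x; exact: mMr.
- by move=> x r; exact: mMl.
- by move=> x /mU [y [yx xy]]; exists y.
Qed.

(** * Factorization into a unit and a power of a generator of the maximal ideal *)

Section LocalDuo.
Variables (R : nzRingType) (m : R -> Prop).
Hypothesis (ld : local_duo m).

Lemma maxN x : m x -> m (- x).
Proof. by move=> mx; rewrite -mulN1r; apply: maxMl. Qed.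

Lemma max_not_invertible x : invertible x -> ~ m x.
Proof. by case=> y [yx _] mx; apply: (max_proper ld); rewrite -yx; apply: maxMl. Qed.

Lemma one_sub_max x : m x -> invertible (1 - x).
Proof.
move=> mx; apply: (max_compl ld) => m1x; apply: (max_proper ld).
by rewrite -(subrK x 1); apply: maxD.
Qed.

(** A one-element Nakayama argument: [1 - x] is a unit and [y * (1 - x) = 0]. *)
Lemma mul_one_sub_eq0 y x : m x -> y = y * x -> y = 0.
Proof.
move=> /one_sub_max [z [_ xz]] yx.
by rewrite -[y]mulr1 -xz mulrA mulrBr mulr1 -yx subrr mul0r.
Qed.

Lemma one_sub_mul_eq0 y x : m x -> y = x * y -> y = 0.
Proof.
move=> /one_sub_max [z [zx _]] yx.
by rewrite -[y]mul1r -zx -mulrA mulrBl mul1r -yx subrr mulr0.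
Qed.

Section Uniformizer.
Variable p : R.
Hypothesis (mp : forall x, m x <-> exists r, x = r * p).
Hypothesis noeth : left_noetherian R.

(** Choose x = y p^k with R y maximal. If y = z p, the duo property puts R y inside R z, so
    maximality gives z = r y = r z p = z t p for some r and t; this forces z = 0, hence x = 0. So y
    is a unit. *)
Lemma unit_mul_pow x :
  x <> 0 -> exists u k, invertible u /\ x = u * p ^+ k.
Proof.
move=> x0.
pose F (I : R -> Prop) :=
  exists y k, x = y * p ^+ k /\ I = (fun z => exists r, z = r * y).
have [||I [[y [k [xE ->]]] ymax]] := left_noetherian_maximal (F := F) noeth.
- move=> _ [y [k [_ ->]]]; split; first by exists 0; rewrite mul0r.
    by move=> _ _ [a ->] [b ->]; exists (a + b); rewrite mulrDl.
  by move=> r _ [a ->]; exists (r * a); rewrite mulrA.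
- exists (fun z => exists r, z = r * x), x, 0%N.
  by rewrite expr0 mulr1.
exists y, k; split=> //; apply: (max_compl ld) => /mp [z yE].
apply: x0; rewrite xE yE.
have [s zp] := duo_rl ld z p.
have [|w [r' ->]||r zr] := ymax (fun w => exists r, w = r * z) _ _ z.
- by exists z, k.+1; rewrite xE yE exprS mulrA.
- by exists (r' * s); rewrite yE zp mulrA.
- by exists 1; rewrite mul1r.
have [t rz] := duo_lr ld r z.
suff -> : z = 0 by rewrite !mul0r.
apply: (@mul_one_sub_eq0 z (t * p)); first by apply/mp; exists t.
by rewrite mulrA -rz -mulrA -yE.
Qed.

Lemma pow_mem_of_invertible (I : R -> Prop) u k :
  left_ideal I -> invertible u -> I (u * p ^+ k) -> I (p ^+ k).
Proof.
by case=> _ _ IM [v [vu _]] /(IM v); rewrite mulrA vu mul1r.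
Qed.

(** A left ideal is determined by which of the powers p^0, ..., p^(n-1) it contains, and each of
    these finitely many memberships stabilizes along a descending chain. *)
Lemma nilpotent_left_artinian n : p ^+ n = 0 -> left_artinian R.
Proof.
move=> pn I Iid Idec.
have Imono a b x : (a <= b)%N -> I b x -> I a x.
  by move=> /subnK <-; elim: (b - a)%N => //= d IH /Idec /IH.
have stable j : exists N, forall a, (N <= a)%N -> I N (p ^+ j) -> I a (p ^+ j).
  case: (pselect (exists N, ~ I N (p ^+ j))) => [[N NP]|h].
    by exists N => a _ /NP.
  by exists 0%N => a _ _; apply: contrapT => na; apply: h; exists a.
have [f fP] := choice stable.
exists (\max_(j < n) f j) => a aN x Ix.
case: (pselect (x = 0)) => [->|x0]; first by case: (Iid a).
have [u [k [uu xE]]] := unit_mul_pow x0.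
rewrite xE in Ix *; have kn : (k < n)%N.
  rewrite ltnNge; apply/negP => nk; apply: x0.
  by rewrite xE -(subnK nk) exprD pn !mulr0.
have fk : (f k <= \max_(j < n) f j)%N by exact: (leq_bigmax (Ordinal kn)).
have [_ _ IM] := Iid a; apply: IM; apply: fP; first exact: leq_trans aN.
by apply: (Imono _ _ _ fk); apply: pow_mem_of_invertible Ix.
Qed.

Lemma not_nilpotent_domain : (forall n, p ^+ n <> 0) -> domain R.
Proof.
move=> pn a b ab0.
case: (pselect (a = 0)) => [->|a0]; [by left | right].
apply: contrapT => b0.
have [u [k [[u' [u'u _]] aE]]] := unit_mul_pow a0.
have [v [l [[v' [v'v _]] bE]]] := unit_mul_pow b0.
(* Moving [v'] to the right of [b] writes p^(k+l) as u' (a b) s. *)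
have [s sE] := duo_lr ld v' b.
apply: (pn (k + l)%N).
have pl : p ^+ l = b * s by rewrite -sE bE mulrA v'v mul1r.
have pk : p ^+ k = u' * a by rewrite aE mulrA u'u mul1r.
by rewrite exprD pl pk -mulrA [a * _]mulrA ab0 mul0r mulr0.
Qed.

End Uniformizer.

Lemma pid_cases : noetherian R -> principal_ideal_ring R ->
  (artinian R /\ principal_ideal_ring R) \/ principal_ideal_domain R.
Proof.
move=> [noeth _] pir; have [pl _] := pir.
have [p mp] : principal_left_ideal m.
  by apply: pl; split; [exact: max0|exact: maxD|exact: maxMl].
case: (pselect (exists n, p ^+ n = 0)) => [[n pn]|pn]; last first.
  by right; split=> //; apply: (not_nilpotent_domain mp noeth) => n h; apply: pn; exists n.
left; split=> //; have art := nilpotent_left_artinian mp noeth pn.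
(* By the duo property a chain of right ideals is a chain of left ideals. *)
split=> // I Iid; apply: art => k; have [I0 ID IM] := Iid k.
by split=> // r x Ix; have [s ->] := duo_lr ld r x; apply: IM.
Qed.

End LocalDuo.

(** * Spans of finite families, with one generator singled out *)

Section Span.
Variables (R : nzRingType) (M : lmodType R).

Definition span n (x : 'I_n -> M) (v : M) : Prop :=
  exists c : 'I_n -> R, v = \sum_(i < n) c i *: x i.

Definition independent n (x : 'I_n -> M) : Prop :=
  forall c : 'I_n -> R, \sum_(i < n) c i *: x i = 0 -> forall i, c i *: x i = 0.

Lemma spanD n (x : 'I_n -> M) u v : span x u -> span x v -> span x (u + v).
Proof.
move=> [c ->] [d ->]; exists (fun i => c i + d i).
by rewrite -big_split; apply: eq_bigr => i _; rewrite scalerDl.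
Qed.

Lemma spanZ n (x : 'I_n -> M) a u : span x u -> span x (a *: u).
Proof.
move=> [c ->]; exists (fun i => a * c i).
by rewrite scaler_sumr; apply: eq_bigr => i _; rewrite scalerA.
Qed.

(** The position [i] is arbitrary, so that the generator with the least coefficient can be replaced
    without reordering the family. *)
Definition insert n (i : 'I_n.+1) (a : M) (x : 'I_n -> M) : 'I_n.+1 -> M :=
  fun j => oapp x a (unlift i j).

Lemma insert_at n i a (x : 'I_n -> M) : insert i a x i = a.
Proof. by rewrite /insert unlift_none. Qed.

Lemma insert_lift n i a (x : 'I_n -> M) j : insert i a x (lift i j) = x j.
Proof. by rewrite /insert liftK. Qed.

Lemma sum_insert n i a (x : 'I_n -> M) (c : 'I_n.+1 -> R) :
  \sum_(j < n.+1) c j *: insert i a x j =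
  c i *: a + \sum_(j < n) c (lift i j) *: x j.
Proof.
rewrite (bigD1_ord i) //= insert_at; congr (_ + _).
by apply: eq_bigr => j _; rewrite insert_lift.
Qed.

Lemma span_insert n i a (x : 'I_n -> M) v :
  span (insert i a x) v <-> exists r w, span x w /\ v = r *: a + w.
Proof.
split=> [[c ->]|[r [w [[c ->] ->]]]].
  by rewrite sum_insert; do 2!eexists; split; last by []; eexists.
exists (fun j => oapp c r (unlift i j)).
rewrite sum_insert unlift_none /=; congr (_ + _).
by apply: eq_bigr => j _; rewrite liftK.
Qed.

Lemma insert_split n i (x : 'I_n.+1 -> M) : insert i (x i) (fun j => x (lift i j)) = x.
Proof.
by apply/funext => j; rewrite /insert; case: unliftP => [k|] ->.
Qed.

End Span.

(** * Decomposing finitely generated modules when the maximal ideal is principal *)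

Section LeftFGC.
Variables (R : nzRingType) (m : R -> Prop) (p : R).
Hypothesis (ld : local_duo m) (noeth : left_noetherian R).
Hypothesis (mp : forall x, m x <-> exists r, x = r * p).

(* Among all relations between generating families with the given span, take a
   coefficient of least valuation k.  The relation is then p^k times another
   combination, which may replace one generator; the new generator is killed by
   p^k, hence by its coefficient in every relation. *)
Lemma independent_generators (M : lmodType R) n (x : 'I_n -> M) :
  exists y : 'I_n -> M, independent y /\ forall v, span x v <-> span y v.
Proof.
elim: n x => [|n IH] x; first by exists x; split=> // c _ [].
pose P k := exists (y : 'I_n.+1 -> M) (c : 'I_n.+1 -> R) (i : 'I_n.+1) (u : R),
  [/\ forall v, span x v <-> span y v, \sum_i c i *: y i = 0,
      invertible u, c i = u * p ^+ k & c i <> 0].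
have dichotomy (y : 'I_n.+1 -> M) (c : 'I_n.+1 -> R) : (forall v, span x v <-> span y v) ->
    \sum_i c i *: y i = 0 -> forall i, c i = 0 \/
    exists u k, [/\ invertible u, c i = u * p ^+ k & P k].
  move=> xy rel i; case: (pselect (c i = 0)) => [|ci0]; [by left | right].
  have [u [k [uu cE]]] := unit_mul_pow ld mp noeth ci0.
  by exists u, k; split=> //; exists y, c, i, u.
case: (pselect (exists k, P k)) => [exP|noP]; last first.
  exists x; split=> // c rel i.
  have [//|->|[u [k [_ _ Pk]]]] := dichotomy x c _ rel i; first by rewrite scale0r.
  by case: noP; exists k.
have exPb : exists k, `[< P k >] by case: exP => k /asboolP; exists k.
case: (ex_minnP exPb) => k /asboolP[y [c [i [u [xy rel [u' [u'u _]] cE _]]]]] kmin.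
(* Minimality of [k] over all generating families, not just [y], is what lets this apply again to
   the modified family below. *)
have dvd (z : 'I_n.+1 -> M) d : (forall v, span x v <-> span z v) ->
    \sum_j d j *: z j = 0 -> forall j, exists r, d j = r * p ^+ k.
  move=> xz zrel j; have [//||[w [l [_ -> /asboolP/kmin kl]]]] := dichotomy z d _ zrel j.
    by move=> ->; exists 0; rewrite mul0r.
  by exists (w * p ^+ (l - k)); rewrite -mulrA -exprD subnK.
(* Once the relation is scaled so that its coefficient at [i] is p^k, the duo property lets p^k be
   pulled out on the left of every term. *)
have dE0 j : exists r, u' * c j = p ^+ k * r.
  by have [r ->] := dvd _ _ xy rel j; rewrite mulrA; exact: (duo_lr ld).
have [d dE] := choice dE0.
pose w0 := \sum_(j < n) d (lift i j) *: y (lift i j).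
have pz0 : p ^+ k *: (y i + w0) = 0.
  have := congr1 ( *:%R u') rel; rewrite scaler0 scaler_sumr (bigD1_ord i) //=.
  rewrite scalerA cE mulrA u'u mul1r scalerDr scaler_sumr => h; rewrite -[RHS]h.
  by congr (_ + _); apply: eq_bigr => j _; rewrite !scalerA dE.
have [w [wind wspan]] := IH (fun j => y (lift i j)).
have w0s : span (fun j => y (lift i j)) w0 by exists (fun j => d (lift i j)).
have nw0s : span (fun j => y (lift i j)) (- w0) by rewrite -scaleN1r; apply: spanZ.
(* The new generator differs from [y i] by an element of the span of the others. *)
have xz v : span x v <-> span (insert i (y i + w0) (fun j => y (lift i j))) v.
  rewrite xy -{1}[y](insert_split i) !span_insert.
  split=> -[r [t [st ->]]].
    exists r, (t + r *: - w0); split; first by apply: spanD => //; apply: spanZ.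
    by rewrite scalerDr addrACA -scalerDr subrr scaler0 addr0.
  exists r, (r *: w0 + t); split; first by apply: spanD => //; apply: spanZ.
  by rewrite scalerDr addrA.
(* By [dvd] the coefficient [a] is a left multiple of p^k, which kills the new generator; so its
   cyclic module meets the span of the others only in 0. *)
have kill a t : span (fun j => y (lift i j)) t -> a *: (y i + w0) + t = 0 ->
    a *: (y i + w0) = 0.
  move=> [g ->] h; pose e j := oapp g a (unlift i j).
  have [|r] := dvd _ e xz _ i.
    rewrite sum_insert /e unlift_none /= -[RHS]h; congr (_ + _).
    by apply: eq_bigr => j _; rewrite liftK.
  by rewrite /e unlift_none /= => ->; rewrite -scalerA pz0 scaler0.
exists (insert i (y i + w0) w); split=> [e|v]; last first.
  by rewrite xz !span_insert; split=> -[r [t [st ->]]]; exists r, t; split=> //; apply/wspan.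
rewrite sum_insert => erel.
have e0 : e i *: (y i + w0) = 0.
  by apply: (kill _ _ _ erel); apply/wspan; exists (fun j => e (lift i j)).
rewrite e0 add0r in erel => j; rewrite /insert.
by case: unliftP => [j'|] -> //=; apply: wind erel _.
Qed.

Lemma uniformizer_left_FGC : left_FGC R.
Proof.
move=> M [n [x gen]]; have [y [ind sp]] := independent_generators x.
by exists n, y; split=> // v; apply/sp.
Qed.

End LeftFGC.

Lemma pir_left_FGC (R : nzRingType) (m : R -> Prop) : local_duo m ->
  left_noetherian R -> principal_ideal_ring R -> left_FGC R.
Proof.
move=> ld noeth [pl _]; have [p mp] : principal_left_ideal m.
  by apply: pl; split; [exact: max0|exact: maxD|exact: maxMl].
exact: uniformizer_left_FGC ld noeth mp.
Qed.

(** * Quotient of a module by a submodule given as a predicate *)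

Lemma lmod_quotient (R : nzRingType) (V : lmodType R) (S : V -> Prop) :
  S 0 -> (forall u v, S u -> S v -> S (u + v)) -> (forall a u, S u -> S (a *: u)) ->
  exists (Q : lmodType R) (f : V -> Q),
    [/\ forall a u v, f (a *: u + v) = a *: f u + f v,
        forall q, exists v, q = f v & forall v, f v = 0 <-> S v].
Proof.
move=> S0 SD SZ; pose P : V -> bool := fun v => `[< S v >].
have Pz : zmod_closed (P : {pred V}).
  split=> [|u v /asboolP Su /asboolP Sv]; first exact/asboolP.
  by apply/asboolP; apply: SD => //; rewrite -scaleN1r; apply: SZ.
pose PZ : zmodClosed V := HB.pack P (GRing.isZmodClosed.Build V P Pz).
pose Q := Quotient.quot PZ.
pose f v : Q := \pi_Q%qT v.
have fD u v : f (u + v) = f u + f v by rewrite /f piE.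
have fP v : f v = 0 <-> S v.
  have f0 : f 0 = 0 by rewrite /f piE.
  have fE : (f v == f 0) = `[< S v >] by rewrite /f -Quotient.idealrBE subr0.
  rewrite -f0; split=> [/eqP|Sv]; first by rewrite fE => /asboolP.
  by apply/eqP; rewrite fE; apply/asboolP.
have fN u : f (- u) = - f u by rewrite /f piE.
(* Scalars act through a chosen representative; [fZ] shows that the choice is immaterial, and the
   module axioms then descend from [V]. *)
pose sc a (q : Q) : Q := f (a *: repr q).
have fZ a v : sc a (f v) = f (a *: v).
  apply/eqP; rewrite -subr_eq0 -fN -fD -scalerBr; apply/eqP/fP; apply: SZ; apply/fP.
  by rewrite fD fN /f reprK subrr.
have fs q : exists v, q = f v by exists (repr q); rewrite /f reprK.
have scA a b q : sc a (sc b q) = sc (a * b) q.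
  by have [v ->] := fs q; rewrite !fZ scalerA.
have sc1 : left_id 1 sc by move=> q; have [v ->] := fs q; rewrite fZ scale1r.
have scDr : right_distributive sc +%R.
  move=> a q q'; have [v ->] := fs q; have [v' ->] := fs q'.
  by rewrite -fD !fZ scalerDr fD.
have scDl q : {morph sc^~ q : a b / a + b}.
  by move=> a b; have [v ->] := fs q; rewrite !fZ scalerDl fD.
pose QM : lmodType R :=
  HB.pack (Quotient.quot PZ) (GRing.Zmodule_isLmodule.Build R Q scA sc1 scDr scDl).
exists QM, f; split=> // a u v.
by rewrite fD -fZ.
Qed.

(** * Modules on two generators with one relation, and principality of ideals *)

Section TwoGenerators.
Variables (R : nzRingType) (m : R -> Prop).
Hypothesis ld : local_duo m.

(** This identifies [N] with R^2 / R (x, y), where [e1] and [e2] are the images of the standard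
    basis. *)
Definition presented (N : lmodType R) (e1 e2 : N) (x y : R) : Prop :=
  (forall v, exists a b, v = a *: e1 + b *: e2) /\
  (forall a b, a *: e1 + b *: e2 = 0 <-> exists r, a = r * x /\ b = r * y).

(** The right ideal x R + y R is the one left invariant by a change of generators, which multiplies
    the relation row (x, y) on the right. *)
Definition right_gen (x y z : R) : Prop := exists s t, z = x * s + y * t.

Lemma presented_exists x y :
  exists (N : lmodType R) (e1 e2 : N), presented e1 e2 x y.
Proof.
pose V : lmodType R := (R^o * R^o)%type.
pose S (v : V) := exists r, v = (r * x, r * y).
have [|_ _ [a ->] [b ->]|a _ [b ->]|N [f [fl fs fP]]] := @lmod_quotient R V S.
- by exists 0; rewrite !mul0r.
- by exists (a + b); rewrite !mulrDl.
- by exists (a * b); rewrite -!mulrA.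
have fE a b : a *: f (1, 0) + b *: f (0, 1) = f (a, b).
  have f0 : f 0 = 0 by apply/fP; exists 0; rewrite !mul0r.
  have fZ c v : f (c *: v) = c *: f v by rewrite -[c *: v]addr0 fl f0 addr0.
  rewrite -(fZ b) -fl.
  by congr f; apply/pair_equal_spec; split; rewrite /= /GRing.scale /= ?mulr1 ?mulr0 ?addr0 ?add0r.
exists N, (f (1, 0)), (f (0, 1)); split=> [v|a b].
  by have [[a b] ->] := fs v; exists a, b; rewrite fE.
rewrite fE; split=> [/fP [r [-> ->]]|[r [-> ->]]]; first by exists r.
by apply/fP; exists r.
Qed.

Lemma presented_sym (N : lmodType R) (e1 e2 : N) x y :
  presented e1 e2 x y -> presented e2 e1 y x.
Proof.
move=> [gen rel]; split=> [v|a b].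
  by have [a [b ->]] := gen v; exists b, a; rewrite addrC.
by rewrite addrC; split=> [/rel [r []]|[r []]] *; [|apply/rel]; exists r.
Qed.

Lemma right_gen_sym x y z : right_gen x y z -> right_gen y x z.
Proof. by move=> [s [t ->]]; exists t, s; rewrite addrC. Qed.

(** With q the inverse of [p], the change of basis is invertible and turns the row (x, y) into (x q,
    y - x q s). *)
Lemma presented_exchange (N : lmodType R) (e1 e2 : N) x y p s :
  presented e1 e2 x y -> invertible p ->
  exists x' y', presented (p *: e1 + s *: e2) e2 x' y' /\
    forall z, right_gen x y z <-> right_gen x' y' z.
Proof.
move=> [gen rel] [q [qp pq]]; exists (x * q), (y - x * q * s); split.
  split=> [v|a b].
    have [a [b ->]] := gen v; exists (a * q), (b - a * q * s).
    rewrite scalerDr !scalerA -mulrA qp mulr1 -addrA -scalerDl.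
    by rewrite addrCA subrr addr0.
  rewrite scalerDr !scalerA -addrA -scalerDl rel.
  split=> -[r [aE bE]]; exists r.
    have aE' : a = r * (x * q) by rewrite mulrA -aE -mulrA pq mulr1.
    split=> //; rewrite mulrBr -bE mulrA -aE'.
    by rewrite addrC addKr.
  rewrite aE bE -!mulrA qp mulr1; split=> //.
  by rewrite mulrBr !mulrA addrC subrK.
move=> z; split=> -[a [b ->]].
  exists (p * a + s * b), b; rewrite mulrDr mulrBl !mulrA -addrA.
  by rewrite -(mulrA x) qp mulr1 [X in _ = _ + X]addrCA subrr addr0.
exists (q * a - q * s * b), b; rewrite mulrBr mulrBl !mulrA.
by rewrite -!addrA; congr (_ + _); rewrite addrC.
Qed.

(** If all [e1]-coefficients of the [f j] were in [m], expanding [e1] in [f] would give a relation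
    whose first entry is an element of [m] minus 1; but that entry lies in R x, so 1 would be in
    [m]. *)
Lemma presented_pivot (N : lmodType R) (e1 e2 : N) x y n (f : 'I_n -> N) :
  presented e1 e2 x y -> m x -> (forall v, span f v) ->
  exists j p s, invertible p /\ f j = p *: e1 + s *: e2.
Proof.
move=> [gen rel] mx fspan.
have [P hP] := choice (fun j => gen (f j)).
have [S fE] := choice hP.
have [q e1E] := fspan e1.
apply: contrapT => nopivot.
have mP j : m (P j).
  apply: contrapT => nm; apply: nopivot; exists j, (P j), (S j); split=> //.
  exact: max_compl nm.
have [|r [rE _]] := (rel (\sum_j q j * P j - 1) (\sum_j q j * S j)).1.
  apply/eqP; rewrite scalerBl scale1r addrAC subr_eq0 [X in _ == X]e1E.
  rewrite !scaler_suml -big_split /=; apply/eqP.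
  by apply: eq_bigr => j _; rewrite fE scalerDr !scalerA.
apply: (max_proper ld); rewrite -(subKr (\sum_j q j * P j) 1).
apply: maxD => //; last by apply: maxN => //; rewrite rE; apply: maxMl.
elim/big_ind: _ => [|a b|j _]; [exact: max0|exact: maxD|].
exact: maxMl.
Qed.

(* If f is a decomposition of the module on e1, e2 with the single relation
   x e1 + y e2 = 0, two of its members g1, g2 can replace e1, e2.  The relation
   x' g1 + y' g2 = 0 then splits, so (x', 0) = r (x', y') for some r; as r or
   1 - r is invertible, y' = 0 or x' = 0. *)
Lemma two_gen_max_bezout x y : left_two_gen_cyclic R -> m x -> m y ->
  exists a, forall z, right_gen x y z <-> exists s : R, z = a * s.
Proof.
move=> two mx my; have [N [e1 [e2 pres]]] := presented_exists x y.
have [|n [f [fspan find]]] := two N; first by exists e1, e2; case: pres.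
have mgen u v z : m u -> m v -> right_gen u v z -> m z.
  by move=> mu mv [s [t ->]]; apply: maxD => //; apply: maxMr.
have genl u v : right_gen u v u by exists 1, 0; rewrite mulr1 mulr0 addr0.
have genr u v : right_gen u v v by exists 0, 1; rewrite mulr1 mulr0 add0r.
have [j [p [s [pu fj]]]] := presented_pivot pres mx fspan.
have [x1 [y1 [pres1 gen1]]] := presented_exchange s pres pu.
have mx1 : m x1 by apply: (mgen x y) => //; apply/gen1.
have my1 : m y1 by apply: (mgen x y) => //; apply/gen1.
rewrite -fj in pres1.
have [j' [p' [s' [pu' fj']]]] := presented_pivot (presented_sym pres1) my1 fspan.
(* If the indices agreed, p' e2 + (s' - 1) f_j = 0 would be a relation, forcing the unit [p'] into R
   y1, inside [m]. *)
have jj' : j != j'.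
  apply/eqP => jj'; subst j'.
  have [_ rel] := presented_sym pres1.
  have [|r [pE _]] := (rel p' (s' - 1)).1.
    by rewrite scalerBl scale1r addrA -fj' subrr.
  by apply: (max_not_invertible ld pu'); rewrite pE; apply: maxMl.
have [y2 [x2 [pres2 gen2]]] := presented_exchange s' (presented_sym pres1) pu'.
rewrite -fj' in pres2; have {pres2} [_ rel] := presented_sym pres2.
have gen z : right_gen x y z <-> right_gen x2 y2 z.
  rewrite gen1; split; first by move=> /right_gen_sym /gen2 /right_gen_sym.
  by move=> /right_gen_sym /gen2 /right_gen_sym.
have rel2 : x2 *: f j + y2 *: f j' = 0 by apply/rel; exists 1; rewrite !mul1r.
(* The relation is extended by zero to the whole family, so that independence kills each of its two
   terms. *)
pose c k := if k == j then x2 else if k == j' then y2 else 0.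
have csum : \sum_k c k *: f k = 0.
  rewrite (bigD1 j) //= (bigD1 j') 1?eq_sym //= big1 => [|k /andP[kj kj']].
    by rewrite addr0 /c eqxx eq_sym (negPf jj') eqxx.
  by rewrite /c (negPf kj) (negPf kj') scale0r.
have := find c csum j; rewrite /c eqxx => x2f.
have [|r [x2E y2E]] := (rel x2 0).1; first by rewrite scale0r addr0.
have principal u : (forall z, right_gen x y z <-> right_gen u 0 z) ->
    exists a, forall z, right_gen x y z <-> exists s : R, z = a * s.
  move=> h; exists u => z; rewrite h; split=> [[a [b ->]]|[a ->]].
    by exists a; rewrite mul0r addr0.
  by exists a, 0; rewrite mul0r addr0.
case: (pselect (m r)) => [mr|/(max_compl ld) [r' [r'r _]]].
  have x20 := one_sub_mul_eq0 ld mr x2E.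
  by apply: (principal y2) => z; rewrite gen x20; split=> /right_gen_sym.
have y20 : y2 = 0 by rewrite -[y2]mul1r -r'r -mulrA -y2E mulr0.
by apply: (principal x2) => z; rewrite gen y20.
Qed.

Lemma two_gen_bezout x y : left_two_gen_cyclic R ->
  exists a, [/\ exists s : R, x = s * a, exists t : R, y = t * a &
                exists s t : R, a = s * x + t * y].
Proof.
move=> two.
case: (pselect (m x)) => [mx|/(max_compl ld) [x' [x'x _]]]; last first.
  exists 1; split; [by exists x; rewrite mulr1|by exists y; rewrite mulr1|].
  by exists x', 0; rewrite x'x mul0r addr0.
case: (pselect (m y)) => [my|/(max_compl ld) [y' [y'y _]]]; last first.
  exists 1; split; [by exists x; rewrite mulr1|by exists y; rewrite mulr1|].
  by exists 0, y'; rewrite y'y mul0r add0r.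
have [a aP] := two_gen_max_bezout two mx my; exists a; split.
- have [|s ->] := (aP x).1; first by exists 1, 0; rewrite mulr1 mulr0 addr0.
  exact: (duo_rl ld).
- have [|s ->] := (aP y).1; first by exists 0, 1; rewrite mulr1 mulr0 add0r.
  exact: (duo_rl ld).
- have [|s [t ->]] := (aP a).2; first by exists 1; rewrite mulr1.
  have [s' ->] := duo_rl ld x s; have [t' ->] := duo_rl ld y t.
  by exists s', t'.
Qed.

(** Take R a maximal among the principal left ideals inside I. For x in I, Bezout gives R b = R a +
    R x inside I, so R b = R a and x lies in R a. *)
Lemma two_gen_pir :
  left_noetherian R -> left_two_gen_cyclic R -> principal_ideal_ring R.
Proof.
move=> noeth two.
have pl (I : R -> Prop) : left_ideal I -> principal_left_ideal I.
  move=> [I0 ID IM].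
  pose F (J : R -> Prop) := exists a, I a /\ J = (fun z => exists r, z = r * a).
  have [||J [[a [Ia ->]] amax]] := left_noetherian_maximal (F := F) noeth.
  - move=> _ [a [_ ->]]; split; first by exists 0; rewrite mul0r.
      by move=> _ _ [b ->] [c ->]; exists (b + c); rewrite mulrDl.
    by move=> r _ [b ->]; exists (r * b); rewrite mulrA.
  - by exists (fun z => exists r, z = r * 0), 0.
  exists a => x; split=> [Ix|[r ->]]; last exact: IM.
  have [b [[s aE] [t xE] [s' [t' bE]]]] := two_gen_bezout a x two.
  apply: (amax (fun z => exists r, z = r * b)); last by exists t.
    by exists b; split=> //; rewrite bE; apply: ID; apply: IM.
  by move=> _ [r ->]; exists (r * s); rewrite aE mulrA.
split=> // I [I0 ID IM].
have [|a aP] := pl I.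
  by split=> // r x Ix; have [s ->] := duo_lr ld r x; apply: IM.
exists a => x; rewrite aP; split=> -[r ->]; [exact: (duo_lr ld) | exact: (duo_rl ld)].
Qed.

End TwoGenerators.

(** * Closing the cycle of equivalences *)

Lemma finitely_generated_of_two (R : nzRingType) (M : lmodType R) :
  generated_by_two M -> finitely_generated M.
Proof.
move=> [x [y gen]]; exists 2, (fun i => if i == ord0 then x else y) => v.
have [a [b ->]] := gen v; exists (fun i => if i == ord0 then a else b).
by rewrite !big_ord_recl big_ord0 addr0.
Qed.

Theorem theorem3p6 (R : nzRingType) :
  noetherian R -> local_ring R -> duo_ring R ->
  [<-> FGC R;
       left_FGC R;
       left_two_gen_cyclic R;
       (artinian R /\ principal_ideal_ring R) \/ principal_ideal_domain R;
       principal_ideal_ring R;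
       right_FGC R;
       right_two_gen_cyclic R].
Proof.
move=> noeth loc duo; have [nl nr] := noeth.
have [m ld] := local_duoP nl loc duo.
have ldc := local_duo_converse ld.
(* Left ideals of [R^c] are right ideals of [R] by definition, so the two chain conditions are
   convertible. *)
have nlc : left_noetherian R^c := nr.
tfae.
- by case.
- by move=> fgc M /finitely_generated_of_two; apply: fgc.
- by move=> two; apply: (pid_cases ld noeth); apply: two_gen_pir ld nl two.
- by case=> -[].
- by move=> [pl pr]; apply: (pir_left_FGC ldc nlc); split.
- by move=> fgc M /finitely_generated_of_two; apply: fgc.
(* Principality obtained over [R^c] comes with its two sides exchanged. *)
- move=> /(two_gen_pir ldc nlc) [pr pl].
  by split; [apply: (pir_left_FGC ld nl) | apply: (pir_left_FGC ldc nlc)]; split.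
Qed.
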